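(* Let $p$ and $q$ be two fixed primes. Then: (1) if $p\equiv 3\pmod 4$ and $q\equiv 3\pmod 4$, then $H(p,q)=0$; (2) if $p=q\equiv 1\pmod 4$, then $H(p,q)=2$; (3) if $p\neq q$ and exactly one of $p$ and $q$ is $\equiv 3\pmod 4$, then $H(p,q)\le 2$; (4) if $p\neq q$ and both $p$ and $q$ are $\equiv 1\pmod 4$, then $H(p,q)\le 5$.
   Context: A Heron triangle is a (non-degenerate) triangle whose three side lengths and whose area are all positive integers. For positive integers $a,b$, $H(a,b)$ denotes the number of distinct positive integers $c$ such that $a,b,c$ are the side lengths of a Heron triangle. *)

(* Defs.v *)
From HB Require Import structures.
From mathcomp Require Import all_boot all_order all_algebra finmap.
From mathcomp Require Import ring lra.
From mathcomp Require Import boolp classical_sets functions cardinality reals.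

Set Implicit Arguments.
Unset Strict Implicit.
Unset Printing Implicit Defensive.

Import Order.TTheory GRing.Theory Num.Theory.

Local Open Scope classical_set_scope.
Local Open Scope ring_scope.

Section Triangles.
Variable R : realType.
Implicit Types A B C : R * R.

Definition dist A B : R :=
  Num.sqrt ((B.1 - A.1) ^+ 2 + (B.2 - A.2) ^+ 2).

(* Half the area of the parallelogram spanned by B - A and C - A. *)
Definition triangle_area A B C : R :=
  `|(B.1 - A.1) * (C.2 - A.2) - (C.1 - A.1) * (B.2 - A.2)| / 2.

Definition positive_integer (x : R) : Prop :=
  exists2 n : nat, (0 < n)%N & x = n%:R.

(* Three points span a degenerate triangle exactly when the area is 0, so the
   condition on the area also expresses non-degeneracy. *)
Definition Heron_triangle A B C : Prop :=
  [/\ positive_integer (dist B C), positive_integer (dist C A),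
      positive_integer (dist A B) & positive_integer (triangle_area A B C)].

Definition Heron_sides (a b c : nat) : Prop :=
  exists A B C, [/\ Heron_triangle A B C,
    dist B C = a%:R, dist C A = b%:R & dist A B = c%:R].

Definition Heron_third_sides (a b : nat) : set nat :=
  [set c | (0 < c)%N /\ Heron_sides a b c].

(* fset_set sends infinite sets to the empty set; this case does not occur. *)
Lemma finite_Heron_third_sides (a b : nat) :
  finite_set (Heron_third_sides a b).
Proof.
apply: (@sub_finite_set _ _ `I_(2 * (a ^ 2 + b ^ 2)).+1); last exact: finite_II.
move=> c [c0 [A [B [C [_ ha hb hc]]]]] /=.
rewrite ltnS; apply: (@leq_trans (c ^ 2)%N); first by rewrite expnS expn1 leq_pmulr.
have sq X Y : dist X Y ^+ 2 = (Y.1 - X.1) ^+ 2 + (Y.2 - X.2) ^+ 2.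
  by rewrite sqr_sqrtr // addr_ge0 ?sqr_ge0.
rewrite -(ler_nat R) natrM natrD !natrX -ha -hb -hc !sq.
have := sqr_ge0 (C.1 - A.1 + (C.1 - B.1)).
have := sqr_ge0 (C.2 - A.2 + (C.2 - B.2)).
nra.
Qed.

Definition H (a b : nat) : nat := #|` fset_set (Heron_third_sides a b)|%fset.

End Triangles.

(* Main.v *)
Require Import Defs.
From mathcomp Require Import all_boot reals.
From mathcomp Require Import all_order all_algebra all_fingroup cyclic finfield.
From mathcomp Require Import finmap zify ring classical_sets cardinality.

(* Heron's formula says that [c] is the third side of a Heron triangle with sides
   [p], [q] iff [x = (p^2 + q^2 - c^2) / 2] is an integer and
   [x^2 + y^2 = (pq)^2] with [y > 0] even, namely twice the area.  Factor
   [x + iy] in the Gaussian integers.  A prime congruent to 3 mod 4 divides both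
   [x] and [y]; a prime [p = u^2 + v^2] either divides both or contributes
   [(u + iv)^2] or its conjugate.  Up to sign and conjugation few [x] remain.
   When both primes are 1 mod 4, at most four values of [x] are prime to [pq];
   the other ones, divisible by [p] or by [q], yield at most one [c] in total by
   the triangle inequality. *)

Import Order.TTheory GRing.Theory Num.Theory.
Local Open Scope ring_scope.

(** * From Heron triangles to a Diophantine equation *)

(** Squares of sides are listed because [c ^ 2] is affine in the parameter [x] of the Diophantine
    equation; squaring is injective on [nat]. *)
Lemma third_sides_card (R : realType) (a b : nat) (s : seq int) :
  (forall c, Heron_sides R a b c -> (c ^ 2)%:Z \in s) -> (H R a b <= size s)%N.
Proof.
move=> hs; rewrite /H; set F := fset_set _.
rewrite -(size_map (fun c : nat => (c ^ 2)%:Z)).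
apply: uniq_leq_size.
  rewrite map_inj_uniq ?fset_uniq // => m n [] /eqP.
  by rewrite eqn_exp2r // => /eqP.
move=> _ /mapP[c cF ->]; apply: hs.
move: cF; rewrite in_fset_set ?inE; first by case.
exact: finite_Heron_third_sides.
Qed.

(** [k] is the area and [x] the dot product of the two sides meeting at [C]; the second equation is
    Heron's formula. *)
Lemma Heron_sides_diophantine {R : realType} {a b c : nat} : Heron_sides R a b c ->
  exists x k : int, [/\ 0 < k, (c ^ 2)%:Z = a%:Z ^+ 2 + b%:Z ^+ 2 - 2 * x &
    x ^+ 2 + (2 * k) ^+ 2 = a%:Z ^+ 2 * b%:Z ^+ 2].
Proof.
case=> [[A1 A2]] [[B1 B2]] [[C1 C2]] [[_ _ _ [k k0]]].
rewrite /triangle_area /dist /= => area ha hb hc.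
have sq (u v : R) (n : nat) : Num.sqrt (u ^+ 2 + v ^+ 2) = n%:R ->
    n%:R ^+ 2 = u ^+ 2 + v ^+ 2.
  by move=> <-; rewrite sqr_sqrtr // addr_ge0 ?sqr_ge0.
move/sq in ha; move/sq in hb; move/sq in hc.
have {area} hk : (2 * k%:R) ^+ 2 =
    ((B1 - A1) * (C2 - A2) - (C1 - A1) * (B2 - A2)) ^+ 2 :> R.
  by rewrite -area mulrCA divff ?pnatr_eq0 // mulr1 -normrX ger0_norm ?sqr_ge0.
have h16 : 16 * k%:Z ^+ 2 =
    4 * (a%:Z * b%:Z) ^+ 2 - (a%:Z ^+ 2 + b%:Z ^+ 2 - c%:Z ^+ 2) ^+ 2.
  apply: (@intr_inj R).
  transitivity (4 * (2 * k%:R) ^+ 2 : R); first by ring.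
  rewrite hk.
  transitivity (4 * (a%:R ^+ 2 * b%:R ^+ 2) - (a%:R ^+ 2 + b%:R ^+ 2 - c%:R ^+ 2) ^+ 2 : R);
    last by ring.
  by rewrite ha hb hc; ring.
have [x hx] : exists x, a%:Z ^+ 2 + b%:Z ^+ 2 - c%:Z ^+ 2 = 2 * x.
  set z := _ + _ - _ in h16 *; exists (z %/ 2)%Z.
  (* An odd [z] would have an odd square, but [h16] makes [z ^ 2] divisible by 4. *)
  have [//|] : z = 2 * (z %/ 2)%Z \/ z = 2 * (z %/ 2)%Z + 1 by lia.
  by move: h16 => + hz; rewrite hz; clear; lia.
exists x, k%:Z; split; [lia | lia |].
rewrite hx in h16; lia.
Qed.

(** * Gaussian factorisation of sums of two squares *)

Lemma dvdz_primeM (p : nat) (x y : int) : prime p ->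
  (p%:Z %| x * y)%Z = (p%:Z %| x)%Z || (p%:Z %| y)%Z.
Proof. by move=> pp; rewrite !dvdzE abszM /= Euclid_dvdM. Qed.

(* In Gaussian integers: [u + iv] or its conjugate divides [x + iy]. *)
Lemma sum_squares_descent {p : nat} {u v x y n : int} : prime p ->
  p%:Z = u ^+ 2 + v ^+ 2 -> x ^+ 2 + y ^+ 2 = p%:Z * n ->
  exists X Y e, [/\ e = 1 \/ e = -1, X ^+ 2 + Y ^+ 2 = n,
    x = u * X - e * v * Y & y = u * Y + e * v * X].
Proof.
move=> pp puv hxy.
have p0 : p%:Z != 0 by have := prime_gt0 pp; lia.
(* The sign [e] tells which conjugate [u + e iv] is divided out; [X] will be the real part of the
   quotient. *)
have [e [he]] : exists e : int, (e = 1 \/ e = -1) /\ (p%:Z %| u * x + e * v * y)%Z.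
  have : (p%:Z %| (u * x + v * y) * (u * x - v * y))%Z.
    apply/dvdzP; exists (u ^+ 2 * n - y ^+ 2).
    transitivity (u ^+ 2 * (p%:Z * n) - y ^+ 2 * p%:Z); last by ring.
    by rewrite -hxy puv; ring.
  rewrite dvdz_primeM // => /orP[h|h]; [exists 1|exists (-1)]; split; auto.
    by rewrite mul1r.
  by rewrite mulN1r mulNr.
have e2 : e ^+ 2 = 1 by case: he => ->.
move=> /dvdzP[X hX].
(* The norm of [(u - e iv)(x + iy)] is [p ^ 2 * n] and its real part is [X * p], so [p] divides the
   square of the imaginary part. *)
have : (p%:Z %| (u * y - e * v * x) * (u * y - e * v * x))%Z.
  apply/dvdzP; exists (p%:Z * n - X ^+ 2 * p%:Z).
  transitivity (p%:Z * (p%:Z * n) - (X * p%:Z) ^+ 2); last by ring.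
  rewrite -hX -hxy puv.
  transitivity ((u * y - e * v * x) * (u * y - e * v * x) +
    (1 - e ^+ 2) * v ^+ 2 * (x ^+ 2 + y ^+ 2)); last by ring.
  by rewrite e2; ring.
rewrite dvdz_primeM // orbb => /dvdzP[Y hY].
have ex : x = u * X - e * v * Y.
  apply: (mulIf p0); transitivity (u * (X * p%:Z) - e * v * (Y * p%:Z)); last by ring.
  rewrite -hX -hY {1}puv.
  transitivity (u ^+ 2 * x + e ^+ 2 * v ^+ 2 * x); [rewrite e2|]; ring.
have ey : y = u * Y + e * v * X.
  apply: (mulIf p0); transitivity (u * (Y * p%:Z) + e * v * (X * p%:Z)); last by ring.
  rewrite -hX -hY {1}puv.
  transitivity (u ^+ 2 * y + e ^+ 2 * v ^+ 2 * y); [rewrite e2|]; ring.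
exists X, Y, e; split=> //; apply: (mulfI p0).
rewrite -hxy {1}puv ex ey.
transitivity ((u ^+ 2 + e ^+ 2 * v ^+ 2) * (X ^+ 2 + Y ^+ 2)); [rewrite e2|]; ring.
Qed.

(** Two descents. Equal signs multiply to [(u + e iv) ^ 2], with real part [u ^ 2 - v ^ 2] and
    imaginary part [e * (2 * u * v)]; opposite signs multiply to [p] itself. *)
Lemma sum_squares_descent2 {p : nat} {u v x y n : int} : prime p ->
  p%:Z = u ^+ 2 + v ^+ 2 -> x ^+ 2 + y ^+ 2 = p%:Z ^+ 2 * n ->
  (p%:Z %| x)%Z /\ (p%:Z %| y)%Z \/
  exists X Y e, [/\ e = 1 \/ e = -1, X ^+ 2 + Y ^+ 2 = n,
    x = (u ^+ 2 - v ^+ 2) * X - e * (2 * u * v) * Y &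
    y = (u ^+ 2 - v ^+ 2) * Y + e * (2 * u * v) * X].
Proof.
move=> pp puv hxy.
have [X1 [Y1 [e1 [he1 n1 -> ->]]]] : exists X Y e,
    [/\ e = 1 \/ e = -1, X ^+ 2 + Y ^+ 2 = p%:Z * n,
      x = u * X - e * v * Y & y = u * Y + e * v * X].
  by apply: (sum_squares_descent pp puv); rewrite hxy; ring.
have [X [Y [e [he hn -> ->]]]] := sum_squares_descent pp puv n1.
have e2 : e1 ^+ 2 = 1 by case: he1 => ->.
have [->|->] : e = e1 \/ e = - e1 by case: he => ->; case: he1 => ->; auto.
  right; exists X, Y, e1; split=> //.
    transitivity ((u ^+ 2 - e1 ^+ 2 * v ^+ 2) * X - e1 * (2 * u * v) * Y); [|rewrite e2]; ring.
  transitivity ((u ^+ 2 - e1 ^+ 2 * v ^+ 2) * Y + e1 * (2 * u * v) * X); [|rewrite e2]; ring.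
left; split; apply/dvdzP; [exists X|exists Y]; rewrite puv -[v ^+ 2]mul1r -e2; ring.
Qed.

Lemma sum_squares1 {x y : int} : x ^+ 2 + y ^+ 2 = 1 ->
  (x = 1 \/ x = -1) /\ y = 0 \/ x = 0 /\ (y = 1 \/ y = -1).
Proof.
move=> h.
have [hx|[hx|hx]] : x = 1 \/ x = -1 \/ x = 0 by nia.
- by left; split; [left|nia].
- by left; split; [right|nia].
right; split=> //; move: h; rewrite hx expr0n add0r => /eqP.
by rewrite sqrf_eq1 => /orP[] /eqP; auto.
Qed.

(** Otherwise -1 is the square of [t = x / y] in ['F_p]; as [(p - 1) / 2] is odd, [t ^ (p - 1)] is
    -1, against Fermat's little theorem. *)
Lemma prime3mod4_sum_squares {p : nat} {x y : int} : prime p -> p = 3 %[mod 4] ->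
  (p%:Z %| x ^+ 2 + y ^+ 2)%Z -> (p%:Z %| x)%Z /\ (p%:Z %| y)%Z.
Proof.
move=> pp p3; have pF := pchar_Fp pp.
rewrite !(dvdz_pcharf pF) rmorphD !rmorphXn /=.
set a : 'F_p := x%:~R; set b : 'F_p := y%:~R => ab.
have [b0|b0] := eqVneq b 0.
  by move: ab; rewrite b0 expr0n addr0 expf_eq0.
have tt : (a / b) ^+ 2 = -1.
  apply/eqP; rewrite -addr_eq0 expr_div_n.
  by rewrite -[1](@divff _ (b ^+ 2)) ?expf_neq0 // -mulrDl mulf_eq0 ab.
have t0 : a / b != 0.
  apply/eqP => t0; move/eqP: tt; rewrite t0 expr0n eq_sym oppr_eq0.
  by rewrite oner_eq0.
have : (a / b) ^+ p.-1 = 1.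
  apply: (mulfI t0); rewrite -exprS prednK ?prime_gt0 // mulr1.
  by rewrite -{2}(expf_card (a / b)) card_Fp.
have -> : p.-1 = (2 * (2 * (p %/ 4)).+1)%N by lia.
rewrite exprM tt exprS exprM sqrrN !expr1n mulr1 => /eqP.
rewrite -subr_eq0 -opprD oppr_eq0 -[_ + _]/(2%:R) -(dvdn_pcharf pF) => /dvdn_leq.
lia.
Qed.

(** * Primes congruent to 1 modulo 4 as sums of two squares *)

Lemma sqrt_floor (n : nat) : exists s : nat, (s ^ 2 <= n < s.+1 ^ 2)%N.
Proof.
elim: n => [|n [s hs]]; first by exists 0%N.
have [h|h] := leqP (s.+1 ^ 2) n.+1; [exists s.+1|exists s]; nia.
Qed.

(** The unit group of ['F_p] is cyclic of order divisible by 4, and an element of order 4 squares to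
    -1. *)
Lemma prime1mod4_sqrtN1 {p : nat} : prime p -> p = 1 %[mod 4] ->
  exists r : 'F_p, r ^+ 2 = -1.
Proof.
move=> pp p1; have /cyclicP[g hg] := field_unit_group_cyclic [set: {unit 'F_p}]%G.
have p4 : (p.-1 = 4 * (p %/ 4))%N by lia.
have og : #[g]%g = p.-1 by rewrite orderE -hg /= card_finField_unit card_Fp.
set x := (g ^+ (p %/ 4))%g.
have ox : #[x]%g = 4%N.
  rewrite orderXdiv og p4 ?dvdn_mull // mulnK //.
  by have := prime_gt1 pp; lia.
have x2 : val x ^+ 2 != 1.
  apply/negP => /eqP; rewrite -FinRing.val_unitX -FinRing.val_unit1 => /val_inj /eqP.
  by rewrite -order_dvdn ox.
have x4 : val x ^+ 4 = 1 by rewrite -FinRing.val_unitX -ox expg_order.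
exists (val x); apply/eqP; move/eqP: x4.
by rewrite (exprM _ 2 2) sqrf_eq1 (negPf x2).
Qed.

Lemma sqr_subz_le (m n s : nat) : (m <= s)%N -> (n <= s)%N ->
  (m%:Z - n%:Z) ^+ 2 <= s%:Z ^+ 2.
Proof.
move=> ms ns; rewrite -subr_ge0 subr_sqr; apply: mulr_ge0; lia.
Qed.

Lemma prime_not_square {p : nat} (s : nat) : prime p -> (s ^ 2 != p)%N.
Proof.
move=> pp; apply/eqP => sp; have [p1 /(_ s)] := primeP pp.
by rewrite -{1}sp dvdn_exp // => /(_ isT) /orP[] /eqP; nia.
Qed.

(* Thue's pigeonhole argument. *)
Lemma prime1mod4_sum_squares {p : nat} : prime p -> p = 1 %[mod 4] ->
  exists u v : int, p%:Z = u ^+ 2 + v ^+ 2.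
Proof.
move=> pp /(prime1mod4_sqrtN1 pp)[r hr]; have pF := pchar_Fp pp.
have [s hs] := sqrt_floor p.
pose f (ij : 'I_s.+1 * 'I_s.+1) : 'F_p := (ij.1)%:R - r * (ij.2)%:R.
(* There are [(s + 1) ^ 2 > p] pairs, so two of them collide under [f]. *)
have /injectivePn[[i j] [[i' j'] /= hij fij]] : ~~ injectiveb f.
  apply/negP => /injectiveP /leq_card.
  by rewrite card_prod card_Fp // !card_ord; lia.
pose u : int := i%:Z - i'%:Z; pose v : int := j%:Z - j'%:Z.
(* A collision means [u = r * v] in ['F_p], where [r ^ 2 = -1]. *)
have uv : (p%:Z %| u ^+ 2 + v ^+ 2)%Z.
  rewrite (dvdz_pcharf pF) rmorphD !rmorphXn !rmorphB /= -!pmulrn.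
  have -> : (i%:R - i'%:R : 'F_p) = r * (j%:R - j'%:R).
    apply/eqP; rewrite mulrBr -subr_eq0; move/eqP: fij; rewrite -subr_eq0 /f /=.
    by move=> /eqP<-; apply/eqP; ring.
  by rewrite exprMn hr mulN1r addNr.
exists u, v.
have ss := prime_not_square s pp.
have uv0 : 0 < u ^+ 2 + v ^+ 2.
  rewrite lt_def addr_ge0 ?sqr_ge0 // andbT paddr_eq0 ?sqr_ge0 // !sqrf_eq0.
  apply: contra hij; rewrite !subr_eq0 => /andP[/eqP[ii'] /eqP[jj']].
  by apply/eqP; congr pair; apply/val_inj.
have := ltn_ord i; have := ltn_ord i'; have := ltn_ord j; have := ltn_ord j'.
rewrite !ltnS => js' js is' is_.
have us : u ^+ 2 <= s%:Z ^+ 2 by apply: sqr_subz_le.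
have vs : v ^+ 2 <= s%:Z ^+ 2 by apply: sqr_subz_le.
(* Strict because [p] is not a square: the positive multiple [u ^ 2 + v ^ 2] of [p] is then below
   [2 * p]. *)
have sp : s%:Z ^+ 2 < p%:Z by clear -hs ss; lia.
case/dvdzP: uv uv0 us vs => k; move: (u ^+ 2) (v ^+ 2) => U V hk.
have k1 : k = 1 \/ k <= 0 \/ 2 <= k by lia.
by clear -hk k1 sp; nia.
Qed.

(** * Solutions of the Heron equation by residue class *)

Lemma prime3mod4_sum_squares_descent {p : nat} {x y n : int} :
  prime p -> p = 3 %[mod 4] -> x ^+ 2 + y ^+ 2 = p%:Z ^+ 2 * n ->
  exists X Y, [/\ X ^+ 2 + Y ^+ 2 = n, x = p%:Z * X & y = p%:Z * Y].
Proof.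
move=> pp p3 hxy.
have p0 : p%:Z ^+ 2 != 0 by rewrite expf_neq0 //; have := prime_gt0 pp; lia.
have [|/dvdzP[X hX] /dvdzP[Y hY]] := @prime3mod4_sum_squares p x y pp p3.
  by rewrite hxy; apply/dvdzP; exists (p%:Z * n); ring.
exists X, Y; split; [|by rewrite hX mulrC|by rewrite hY mulrC].
by apply: (mulfI p0); rewrite -hxy hX hY; ring.
Qed.

(** Keeps the second coordinate, initially twice the area, even when an odd prime is divided out. *)
Lemma even_cofactor (p : nat) (y k : int) : odd p -> p%:Z * y = 2 * k ->
  exists w, y = 2 * w.
Proof.
move=> op hy; exists (k - (p./2)%:Z * y).
have hp : p%:Z = 2 * (p./2)%:Z + 1 by lia.
move: hy; rewrite hp; lia.
Qed.

(** The left side is 0 and the right side 1 modulo 4. This discards the Gaussian units [i] and [-i],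
    which would make [x] even. *)
Lemma odd_sqr_sum_even (n : nat) (x y : int) : odd n ->
  (- (2 * x)) ^+ 2 + (2 * y) ^+ 2 = n%:Z ^+ 2 -> False.
Proof.
move=> on; have -> : n%:Z = 2 * (n./2)%:Z + 1 by lia.
move: (n./2)%:Z => m; clear; lia.
Qed.

(** Dividing by [p] and [q] leaves [X' + iY'] of norm 1 with [Y'] even and nonzero, which no unit
    satisfies. *)
Lemma Heron_both3mod4 {p q : nat} {x k : int} : prime p -> prime q ->
  p = 3 %[mod 4] -> q = 3 %[mod 4] -> 0 < k ->
  x ^+ 2 + (2 * k) ^+ 2 = p%:Z ^+ 2 * q%:Z ^+ 2 -> False.
Proof.
move=> pp pq p3 q3 k0.
case/(prime3mod4_sum_squares_descent pp p3) => X [Y []].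
rewrite -[_ ^+ 2 in RHS]mulr1.
case/(prime3mod4_sum_squares_descent pq q3) => X' [Y' [XY _ ->]] _ /esym hk.
have op : odd p by lia.
have [w hw] := even_cofactor _ _ _ op hk.
have oq : odd q by lia.
have [z hz] := even_cofactor _ _ _ oq hw.
by move: hk; rewrite hz; case: (sum_squares1 XY) => -[] _; lia.
Qed.

Lemma Heron_one3mod4 {p q : nat} : prime p -> prime q ->
  p = 3 %[mod 4] -> q <> 3 %[mod 4] ->
  exists x0 : int, forall x k : int, 0 < k ->
    x ^+ 2 + (2 * k) ^+ 2 = p%:Z ^+ 2 * q%:Z ^+ 2 -> x = x0 \/ x = - x0.
Proof.
move=> pp pq p3 q3.
have op : odd p by lia.
suff [x0 hx0] : exists x0 : int, forall x w : int, w != 0 ->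
    x ^+ 2 + (2 * w) ^+ 2 = q%:Z ^+ 2 -> x = x0 \/ x = - x0.
  exists (p%:Z * x0) => x k k0.
  case/(prime3mod4_sum_squares_descent pp p3) => X [Y [+ -> /esym hY]].
  have [w hw] := even_cofactor _ _ _ op hY.
  rewrite hw => /hx0[|->|->]; [|by left|by right; rewrite mulrN].
  by apply/eqP => w0; rewrite hw w0 !mulr0 in hY; lia.
(* For [q = 2] the term [(2 * w) ^ 2] already exhausts the right side, so [x = 0]. *)
have [q2|q2] := eqVneq q 2%N.
  exists 0 => x w w0; rewrite q2 => hxw; left.
  have : 1 <= w ^+ 2 by have := exprn_even_gt0 w (isT : ~~ odd 2); rewrite w0 orbT; lia.
  have := sqr_ge0 x => x0 w1; apply/eqP; rewrite -sqrf_eq0; apply/eqP; lia.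
have oq : odd q by have := even_prime pq; lia.
have q1 : q = 1 %[mod 4] by lia.
have [u [v huv]] := prime1mod4_sum_squares pq q1.
exists (u ^+ 2 - v ^+ 2) => x w w0 hxw.
have q0 := prime_gt0 pq.
have hxw1 : x ^+ 2 + (2 * w) ^+ 2 = q%:Z ^+ 2 * 1 by rewrite mulr1.
have [[_ /dvdzP[y hy]]|] := sum_squares_descent2 pq huv hxw1.
  (* Here [w] is a nonzero multiple of [q], so [(2 * w) ^ 2] exceeds [q ^ 2]. *)
  have /esym hy' := hy; rewrite mulrC in hy'.
  have [z hz] := even_cofactor _ _ _ oq hy'.
  have z0 : z != 0 by apply/eqP => z0; move: hy w0; rewrite hz z0; lia.
  have : 1 <= z ^+ 2 by have := exprn_even_gt0 z (isT : ~~ odd 2); rewrite z0 orbT; lia.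
  have := sqr_ge0 x; move: hxw; rewrite hy hz => hxw x2 z2.
  have : 0 <= q%:Z ^+ 2 * (z ^+ 2 - 1) by rewrite mulr_ge0 ?sqr_ge0 ?subr_ge0.
  have : 0 < q%:Z ^+ 2 by rewrite exprn_gt0.
  move: hxw x2; clear; lia.
move=> [X [Y [e [he /sum_squares1 hXY hx hy]]]].
case: hXY => -[hX hY].
  by move: hX hx; rewrite hY => -[->|->] ->; [left|right]; ring.
exfalso; move: hx; rewrite hX mulr0 sub0r.
set t := e * (2 * u * v) * Y.
have -> : t = 2 * (e * u * v * Y) by rewrite /t; ring.
move=> hx; move: hxw; rewrite hx.
by move: (e * _) => d; exact: odd_sqr_sum_even oq.
Qed.

(** Up to sign, [x] is the real part of [(u + iv) ^ 2] times [(w + iz) ^ 2] or times its conjugate;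
    these are [x1] and [x2]. *)
Lemma Heron_both1mod4_coprime {p q : nat} : prime p -> prime q ->
  p = 1 %[mod 4] -> q = 1 %[mod 4] ->
  exists x1 x2 : int, forall x k : int,
    x ^+ 2 + (2 * k) ^+ 2 = p%:Z ^+ 2 * q%:Z ^+ 2 ->
    ~~ (p%:Z %| x)%Z -> ~~ (q%:Z %| x)%Z ->
    x \in [:: x1; - x1; x2; - x2].
Proof.
move=> pp pq p1 q1; have op : odd p by lia.
have oq : odd q by lia.
have [u [v puv]] := prime1mod4_sum_squares pp p1.
have [w [z qwz]] := prime1mod4_sum_squares pq q1.
set A := u ^+ 2 - v ^+ 2; set C := w ^+ 2 - z ^+ 2.
exists (A * C - 4 * u * v * w * z), (A * C + 4 * u * v * w * z) => x k hxk px qx.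
have [[px' _]|[X [Y [e [he XY hx _]]]]] := sum_squares_descent2 pp puv hxk.
  by rewrite px' in px.
rewrite -[_ ^+ 2 in RHS]mulr1 in XY.
have [[qX qY]|[X' [Y' [e' [he' XY' hX hY]]]]] := sum_squares_descent2 pq qwz XY.
  by case/negP: qx; rewrite hx rpredB // dvdz_mull.
rewrite !inE; have [[hX' hY']|[hX' hY']] := sum_squares1 XY'.
  have -> : x = X' * (A * C - e * e' * (4 * u * v * w * z)).
    by rewrite hx hX hY hY' /A /C; ring.
  by case: hX' => ->; case: he => ->; case: he' => ->;
     rewrite ?(mulrN, mulNr, mul1r, opprK) eqxx ?orbT.
exfalso; have hx2 : x = - (2 * (Y' * (A * e' * w * z + e * u * v * C))).
  by rewrite hx hX hY hX' /A /C; ring.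
have hpq : x ^+ 2 + (2 * k) ^+ 2 = (p * q)%N%:Z ^+ 2 by rewrite hxk PoszM exprMn.
have opq : odd (p * q) by rewrite oddM op oq.
by rewrite hx2 in hpq; exact: (odd_sqr_sum_even _ _ _ opq hpq).
Qed.

Lemma ltz_sqrW {a b : int} : 0 <= b -> a ^+ 2 < b ^+ 2 -> a < b.
Proof.
move=> b0; rewrite !ltNge; apply: contra => ba.
by rewrite ler_sqr // nnegrE (le_trans b0).
Qed.

(* With [n = p %/ q], the semiperimeter of such a triangle is [(n + 1) q]: it is
   a multiple of [q] trapped between [p] and [p + q]. *)
Lemma Heron_both_odd_dvd {p q c : nat} {x k : int} : prime q ->
  odd p -> odd q -> 0 < k ->
  (c ^ 2)%:Z = p%:Z ^+ 2 + q%:Z ^+ 2 - 2 * x ->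
  x ^+ 2 + (2 * k) ^+ 2 = p%:Z ^+ 2 * q%:Z ^+ 2 -> (q%:Z %| x)%Z ->
  (q < p)%N /\ c = ((p %/ q).*2.+1 * q - p)%N.
Proof.
move=> pq op oq k0 hc hxk qx.
have q0 := prime_gt0 pq.
have [xlt ltx] : x < p%:Z * q%:Z /\ - (p%:Z * q%:Z) < x.
  have : `|x| < p%:Z * q%:Z.
    rewrite -(@ltr_pXn2r _ 2) ?nnegrE ?mulr_ge0 // real_normK ?num_real //.
    by rewrite exprMn -hxk ltrDl exprn_gt0 // mulr_gt0.
  by rewrite ltr_norml => /andP[].
(* By the law of cosines, [|x| < p * q] yields the strict triangle inequalities. *)
have c1 : p%:Z - q%:Z < c%:Z by apply: ltz_sqrW => //; move: hc xlt; clear; lia.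
have c2 : q%:Z - p%:Z < c%:Z by apply: ltz_sqrW => //; move: hc xlt; clear; lia.
have c3 : c%:Z < p%:Z + q%:Z by apply: ltz_sqrW => //; move: hc ltx; clear; lia.
have oc : ~~ odd c.
  suff [y hy] : exists y, c%:Z ^+ 2 = 2 * y.
    apply/negP => oc; have hc1 : c%:Z = 2 * (c./2)%:Z + 1 by lia.
    by move: hy; rewrite hc1; clear; lia.
  have hp : p%:Z = 2 * (p./2)%:Z + 1 by lia.
  have hq' : q%:Z = 2 * (q./2)%:Z + 1 by lia.
  exists (2 * ((p./2)%:Z ^+ 2 + (p./2)%:Z + (q./2)%:Z ^+ 2 + (q./2)%:Z) + 1 - x).
  by move: hc; rewrite hp hq'; clear; lia.
have : (q%:Z %| (c%:Z - p%:Z) * (c%:Z + p%:Z))%Z.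
  rewrite -subr_sqr; case/dvdzP: qx => y hy; apply/dvdzP; exists (q%:Z - 2 * y).
  by move: hc; rewrite hy; clear; lia.
rewrite dvdz_primeM // => /orP[] /dvdzP[m hm].
  (* [q] divides [c - p], whose absolute value is below [q]; then [c = p] is odd, but [c] is
     even. *)
  have m0 : m = 0 by move: hm c1 c2 c3 q0; clear; nia.
  by move: hm op oc; rewrite m0; clear; lia.
have m0 : 0 < m.
  by rewrite -(@pmulr_lgt0 _ q%:Z) ?ltz_nat // -hm; move: c1 c2 q0; clear; lia.
have [m' em] : exists m' : nat, m = m' by exists `|m|%N; rewrite gtz0_abs.
have {}hm : (c + p = m' * q)%N by move: hm; rewrite em; clear; lia.
have om : odd m' by have := congr1 odd hm; rewrite oddD oddM op oq (negPf oc) andbT.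
pose n := m'./2; have em' : m' = n.*2.+1 by rewrite /n; clear -om; lia.
rewrite {om}em' in hm.
(* With [c = (2 * n + 1) * q - p], the triangle inequalities read [n * q < p < (n + 1) * q] and
   [0 < n]. *)
have n1 : (n * q < p)%N by clear -hm c3; nia.
have n2 : (p < n.+1 * q)%N by clear -hm c1; nia.
have n0 : (0 < n)%N by case: (n) hm => // hm; clear -hm c2; lia.
have -> : (p %/ q)%N = n.
  by apply/eqP; rewrite eqn_leq leq_divRL // (ltnW n1) -ltnS ltn_divLR // n2.
by split; [clear -n1 n0; nia | rewrite -hm addnK].
Qed.

(** * The isosceles case *)

(** The base [c] is even and the height on it is an integer, so [c / 2] is a leg of a right triangle
    with hypotenuse [p], whose legs are unique. *)
Lemma Heron_isosceles_sides {p c : nat} {u v x k : int} : prime p ->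
  p%:Z = u ^+ 2 + v ^+ 2 -> 0 < k ->
  (c ^ 2)%:Z = p%:Z ^+ 2 + p%:Z ^+ 2 - 2 * x ->
  x ^+ 2 + (2 * k) ^+ 2 = p%:Z ^+ 2 * p%:Z ^+ 2 ->
  c = (2 * `|(u ^+ 2 - v ^+ 2)%R|)%N \/ c = (2 * `|(2 * u * v)%R|)%N.
Proof.
move=> pp puv k0 hc hxk.
have oc : ~~ odd c.
  apply/negP => oc; have hc1 : c%:Z = 2 * (c./2)%:Z + 1 by clear -oc; lia.
  have : c%:Z ^+ 2 = 2 * (p%:Z ^+ 2 - x) by move: hc; clear; lia.
  by rewrite hc1; clear; lia.
pose m := c./2; have cm : c = m.*2 by rewrite /m; clear -oc; lia.
have hx : x = p%:Z ^+ 2 - 2 * m%:Z ^+ 2 by move: hc; rewrite cm; clear; lia.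
have hk : k ^+ 2 = m%:Z ^+ 2 * (p%:Z ^+ 2 - m%:Z ^+ 2).
  by move: hxk; rewrite hx; clear; lia.
have m0 : (0 < m)%N by case: (m) hk => // hk; move: k0; clear -hk; nia.
(* [m ^ 2] divides [k ^ 2], so [m] divides the area [k]; the quotient is the height. *)
have [h hh] : exists h : int, k = h * m%:Z.
  apply/dvdzP; rewrite dvdzE /= -(@dvdn_pexp2r _ _ 2) //.
  have := dvdz_mulr (p%:Z ^+ 2 - m%:Z ^+ 2) (dvdzz (m%:Z ^+ 2)).
  by rewrite -hk dvdzE !abszX.
have hmh : m%:Z ^+ 2 + h ^+ 2 = p%:Z ^+ 2 * 1.
  have mn0 : m%:Z ^+ 2 != 0 by rewrite expf_neq0 // lt0r_neq0.
  by apply: (mulfI mn0); move: hk; rewrite hh; clear; lia.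
have h0 : 0 < h ^+ 2.
  by rewrite exprn_even_gt0 //=; apply: contraTneq k0 => h0; rewrite hh h0 mul0r ltxx.
have [[pm _]|[X [Y [e [he XY hm _]]]]] := sum_squares_descent2 pp puv hmh.
  have pm' : (p <= m)%N by apply: dvdn_leq => //; move: pm; rewrite dvdzE.
  have : p%:Z ^+ 2 <= m%:Z ^+ 2 by rewrite ler_sqr ?nnegrE // lez_nat.
  by move: hmh h0; clear; lia.
have -> : c = (2 * `|m%:Z|)%N by rewrite cm /= mul2n.
rewrite hm; have [[hX ->]|[-> hY]] := sum_squares1 XY; [left|right].
  by case: hX => ->; rewrite mulr0 subr0 ?mulrN1 ?mulr1 ?abszN.
by case: hY => ->; case: he => ->; rewrite mulr0 sub0r ?mulrN1 ?mulr1 ?mul1r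
   ?mulN1r ?abszN ?mulNr ?abszN.
Qed.

(** Two right triangles with legs [m] and [h] are glued along [h]; the area is [m * h]. *)
Lemma Heron_sides_isosceles (R : realType) (p m h : nat) : (0 < m)%N -> (0 < h)%N ->
  (m ^ 2 + h ^ 2 = p ^ 2)%N -> Heron_sides R p p (2 * m).
Proof.
move=> m0 h0 hmh.
have p0 : (0 < p)%N by case: p hmh => //; clear -m0 h0; nia.
have hR : m%:R ^+ 2 + h%:R ^+ 2 = p%:R ^+ 2 :> R by rewrite -!natrX -hmh natrD.
have dist_p (A B : R * R) : (B.1 - A.1) ^+ 2 + (B.2 - A.2) ^+ 2 = p%:R ^+ 2 ->
    dist A B = p%:R.
  by rewrite /dist => ->; rewrite sqrtr_sqr ger0_norm.
have dBC : dist (m%:R, 0) (0, h%:R) = p%:R :> R.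
  by apply: dist_p; rewrite -hR /=; ring.
have dCA : dist (0, h%:R) (- m%:R, 0) = p%:R :> R.
  by apply: dist_p; rewrite -hR /=; ring.
have dAB : dist (- m%:R, 0) (m%:R, 0) = (2 * m)%:R :> R.
  rewrite /dist /= subrr expr0n addr0 sqrtr_sqr opprK natrM.
  by rewrite ger0_norm ?addr_ge0 //; ring.
exists (- m%:R, 0), (m%:R, 0), (0, h%:R); split=> //; split.
- by rewrite dBC; exists p.
- by rewrite dCA; exists p.
- by rewrite dAB; exists (2 * m)%N => //; clear -m0; lia.
exists (m * h)%N; first by rewrite muln_gt0 m0.
rewrite /triangle_area /= natrM.
have -> : (m%:R - - m%:R) * (h%:R - 0) - (0 - - m%:R) * (0 - 0) = 2 * (m%:R * h%:R) :> R by ring.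
by rewrite ger0_norm ?mulr_ge0 // mulrC mulKf ?pnatr_eq0.
Qed.

(** Gluing along either leg of the right triangle with hypotenuse [p] gives the bases [2 * a] and
    [2 * b], distinct since [a] is odd and [b] even. *)
Lemma H_isosceles (R : realType) (p : nat) : prime p -> p = 1 %[mod 4] ->
  H R p p = 2%N.
Proof.
move=> pp p1; have [u [v puv]] := prime1mod4_sum_squares pp p1.
set a := `|(u ^+ 2 - v ^+ 2)%R|%N; set b := `|(2 * u * v)%R|%N.
have ab : (a ^ 2 + b ^ 2 = p ^ 2)%N.
  have : a%:Z ^+ 2 + b%:Z ^+ 2 = p%:Z ^+ 2.
    by rewrite !abszE !real_normK ?num_real // puv; ring.
  by clear; lia.
have ob : ~~ odd b by rewrite /b -mulrA abszM oddM.
have oa : odd a by have := congr1 odd ab; rewrite oddD !oddX /= (negPf ob) addbF => ->; clear -p1; lia.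
have a0 : (0 < a)%N by case: (a) oa.
(* [u * v = 0] would make the prime [p] a square. *)
have b0 : (0 < b)%N.
  rewrite lt0n; apply/eqP => b0; move: puv.
  have : u * v == 0 by move/eqP: b0; rewrite absz_eq0 -mulrA mulf_eq0.
  have sq (w : int) : p%:Z <> w ^+ 2.
    by move=> hw; have := prime_not_square `|w|%N pp; rewrite -abszX -hw eqxx.
  by rewrite mulf_eq0 => /orP[] /eqP ->; rewrite expr0n ?add0r ?addr0 => /sq.
have sides : Heron_third_sides R p p = [set` [fset (2 * a)%N; (2 * b)%N]%fset]%classic.
  apply/seteqP; split=> c /=.
    move=> [_ /Heron_sides_diophantine[x [k [k0 hc hxk]]]].
    by rewrite !inE; case: (Heron_isosceles_sides pp puv k0 hc hxk) => ->; rewrite eqxx ?orbT.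
  rewrite !inE => /orP[] /eqP ->; split.
  - by rewrite muln_gt0.
  - exact: (@Heron_sides_isosceles R p a b).
  - by rewrite muln_gt0.
  - by apply: (@Heron_sides_isosceles R p b a) => //; rewrite addnC.
rewrite /H sides set_fsetK cardfs2 eqn_pmul2l //.
by have -> : a != b by apply: contraNneq ob => <-.
Qed.

(* Counting the third sides *)
Local Close Scope ring_scope.

Theorem theorem2p4 (R : realType) (p q : nat) (hp : prime p) (hq : prime q) :
  [/\ (p = 3 %[mod 4] -> q = 3 %[mod 4] -> H R p q = 0),
      (p = q -> p = 1 %[mod 4] -> H R p q = 2),
      (p <> q ->
         (p = 3 %[mod 4] /\ q <> 3 %[mod 4]) \/
         (p <> 3 %[mod 4] /\ q = 3 %[mod 4]) ->
       H R p q <= 2)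
    & (p <> q -> p = 1 %[mod 4] -> q = 1 %[mod 4] -> H R p q <= 5)].
Proof.
split.
- move=> p3 q3; apply/eqP; rewrite -leqn0.
  apply: (@third_sides_card R p q [::]) => c /Heron_sides_diophantine[x [k [k0 _ hxk]]].
  by case: (Heron_both3mod4 hp hq p3 q3 k0 hxk).
- move=> <- p1; exact: H_isosceles.
- move=> _ h.
  have [x0 hx0] : exists x0 : int, forall x k : int, (0 < k)%R ->
      (x ^+ 2 + (2 * k) ^+ 2 = p%:Z ^+ 2 * q%:Z ^+ 2)%R -> x = x0 \/ x = (- x0)%R.
    case: h => -[h1 h2]; first exact: Heron_one3mod4.
    have [x0 hx0] := Heron_one3mod4 hq hp h2 h1.
    by exists x0 => x k k0 hxk; apply: (hx0 x k k0); rewrite hxk mulrC.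
  apply: (@third_sides_card R p q
    [seq (p%:Z ^+ 2 + q%:Z ^+ 2 - 2 * x)%R | x <- [:: x0; (- x0)%R]]).
  move=> c /Heron_sides_diophantine[x [k [k0 -> hxk]]].
  by apply: (map_f (fun x : int => (p%:Z ^+ 2 + q%:Z ^+ 2 - 2 * x)%R)); rewrite !inE;
     case: (hx0 x k k0 hxk) => ->; rewrite eqxx ?orbT.
move=> _ p1 q1.
have op : odd p by clear -p1; lia.
have oq : odd q by clear -q1; lia.
have [x1 [x2 hx]] := Heron_both1mod4_coprime hp hq p1 q1.
(* The fifth candidate: [q] dividing [x] forces [q < p], and [p] dividing [x] forces [p < q], so
   only one of the two formulas can apply. *)
pose c0 := if q < p then (p %/ q).*2.+1 * q - p else (q %/ p).*2.+1 * p - q.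
apply: (@third_sides_card R p q (Posz (c0 ^ 2) ::
  [seq (p%:Z ^+ 2 + q%:Z ^+ 2 - 2 * x)%R | x <- [:: x1; (- x1)%R; x2; (- x2)%R]])).
move=> c /Heron_sides_diophantine[x [k [k0 hc hxk]]]; rewrite in_cons.
have [qx|qx] := boolP (q%:Z %| x)%Z.
  have [qp ->] := Heron_both_odd_dvd hq op oq k0 hc hxk qx.
  by rewrite /c0 qp eqxx.
have [px|px] := boolP (p%:Z %| x)%Z.
  rewrite [(_ ^+ 2 + _ ^+ 2)%R]addrC in hc; rewrite [RHS]mulrC in hxk.
  have [pq ->] := Heron_both_odd_dvd hp oq op k0 hc hxk px.
  by rewrite /c0 ltnNge ltnW //= eqxx.
by rewrite hc (map_f (fun x : int => (p%:Z ^+ 2 + q%:Z ^+ 2 - 2 * x)%R)) ?orbT // (hx x k).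
Qed.
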